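(* Let $\mathbf t=(t_1,\dots,t_k)\in\mathbb Z^k$ be such that $\mathcal C(X)=X^k-t_1X^{k-1}-\dots-t_k$ is irreducible over $\mathbb Q$, let $K=\mathbb Q(\lambda)$ for a root $\lambda$ with ring of integers $R$, and let $p$ be a prime with $p\nmid t_k$. Assume that $p$ ramifies in $R$ if and only if $p$ divides the discriminant of $\mathcal C$. Then $p$ divides $c_p[\mathbf t]$ if and only if $p$ ramifies in $R$.
   Context: $c_p[\mathbf t]$ is the least positive $c$ with $F_{k,n+c}(\mathbf t)\equiv F_{k,n}(\mathbf t)\pmod p$ for all $n\ge0$, where the Generalized Fibonacci Polynomials satisfy $F_{k,0}=1$, $F_{k,-1}=\dots=F_{k,-(k-1)}=0$, $F_{k,n}=\sum_{j=1}^kt_jF_{k,n-j}$. $p$ ramifies in $R$ if $pR=\mathcal P_1^{\epsilon_1}\cdots\mathcal P_s^{\epsilon_s}$ with some $\epsilon_j>1$. *)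

(* Defs.v *)
From mathcomp Require Export all_boot all_order all_algebra all_field.
From mathcomp Require Export boolp classical_sets.

Set Implicit Arguments.
Unset Strict Implicit.
Unset Printing Implicit Defensive.

Export Order.TTheory GRing.Theory Num.Theory.
Global Open Scope classical_set_scope.
Global Open Scope ring_scope.

(* The parameters (t_1, ..., t_k) are a k.-tuple, so t_j is t`_(j - 1). *)

Definition core_poly (k : nat) (t : k.-tuple int) : {poly int} :=
  'X^k - \sum_(i < k) t`_i *: 'X^(k - i.+1).

(* [:: F_n; F_(n-1); ...; F_0]; reading past the end of the history yields
   nth's default 0, which is the initial value F_m = 0 for -k < m < 0. *)
Fixpoint gfib_hist (k : nat) (t : k.-tuple int) (n : nat) : seq int :=
  if n is m.+1 then
    let h := gfib_hist t m in (\sum_(i < k) t`_i * h`_i) :: h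
  else [:: 1].

Definition gfib (k : nat) (t : k.-tuple int) (n : nat) : int :=
  (gfib_hist t n)`_0.

Lemma gfib_histE (k : nat) (t : k.-tuple int) (n i : nat) :
  (gfib_hist t n)`_i = if (i <= n)%N then gfib t (n - i) else 0.
Proof.
elim: n i => [|n IHn] [|i] //=.
by rewrite nth_nil.
Qed.

Lemma gfib0 (k : nat) (t : k.-tuple int) : gfib t 0 = 1.
Proof. by []. Qed.

Lemma gfibS (k : nat) (t : k.-tuple int) (n : nat) :
  gfib t n.+1 =
  \sum_(i < k) t`_i * (if (i < n.+1)%N then gfib t (n.+1 - i.+1) else 0).
Proof. by apply: eq_bigr => i _; rewrite gfib_histE ltnS subSS. Qed.

Definition gfib_period_of (k : nat) (t : k.-tuple int) (p c : nat) : Prop :=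
  (0 < c)%N /\
  forall n : nat, (gfib t (n + c)%N = gfib t n %[mod p%:Z])%Z.

(* c_p[t], with the default value 0 when the sequence is not purely periodic
   modulo p. *)
Definition gfib_period (p : nat) (k : nat) (t : k.-tuple int) : nat :=
  xget 0%N [set c | gfib_period_of t p c /\
                    forall d : nat, gfib_period_of t p d -> (c <= d)%N].

(* For monic f, so there is no division by the leading coefficient. *)
Definition discriminant (f : {poly int}) : int :=
  (-1) ^+ 'C((size f).-1, 2) * resultant f f^`().

(* Ideals of a subring O of K, as subsets of K. *)
Section Ideals.
Variables (K : fieldType) (O : set K).

Definition is_ideal (I : set K) : Prop :=
  [/\ I `<=` O, I 0, forall x y, I x -> I y -> I (x + y)
    & forall a x, O a -> I x -> I (a * x)].

Definition is_prime_ideal (P : set K) : Prop :=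
  [/\ is_ideal P, ~ P 1
    & forall x y, O x -> O y -> P (x * y) -> P x \/ P y].

Definition principal_ideal (a : K) : set K := [set a * x | x in O].

Definition ideal_mul (I J : set K) : set K :=
  [set x | exists s : seq (K * K),
     (forall u, u \in s -> I u.1 /\ J u.2) /\ x = \sum_(u <- s) u.1 * u.2].

Definition ideal_exp (I : set K) (e : nat) : set K := iter e (ideal_mul I) O.

End Ideals.

Definition ring_of_integers (K : fieldExtType rat) : set K :=
  [set x | integralOver (intr : int -> K) x].

Definition ramifies (K : fieldExtType rat) (p : nat) : Prop :=
  let O := @ring_of_integers K in
  exists (s : nat) (P : 'I_s -> set K) (e : 'I_s -> nat),
    [/\ forall i, is_prime_ideal O (P i),
        injective P,
        forall i, (0 < e i)%N,
        principal_ideal O p%:R =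
          \big[@ideal_mul K/O]_(i < s) ideal_exp O (P i) (e i)
      & exists j, (1 < e j)%N].

(* Main.v *)
Require Import Defs.
From mathcomp Require Import zify.

(** Let [C] be the core polynomial reduced modulo [p]. On [F_p[X]/(C)] the
    linear form "coefficient of [X^(k-1)]" sends [X^(n+k-1)] to [F_n] and
    vanishes on no nonzero ideal, so [c] is a period of the sequence modulo [p]
    exactly when [C] divides [X^c - 1]: here [p] not dividing [t_k] makes [X]
    invertible modulo [C], which also yields a period. If [p] does not divide
    [c], then [X^c - 1], hence [C], is separable; if [c = p m], then
    [X^c - 1 = (X^m - 1)^p], so a separable [C] would divide [X^m - 1] and [c]
    would not be the least period. Hence [p] divides the least period exactly
    when [C] is inseparable, that is, when [p] divides the discriminant. *)

(* The leading coefficient of [q] may be killed by [f], so the resultant of the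
   images need not be the image of the resultant (unlike in [map_resultant]). *)
Lemma resultant_morph_eq0 (R : comNzRingType) (F : fieldType)
    (f : {rmorphism R -> F}) (p q : {poly R}) :
  f (lead_coef p) != 0 ->
  (f (resultant p q) == 0) = ~~ coprimep (map_poly f p) (map_poly f q).
Proof.
move=> lp; set pf := map_poly f p; set qf := map_poly f q.
have p_gt0 : (0 < size p)%N.
  rewrite size_poly_gt0 -lead_coef_eq0; apply: contraNneq lp => ->.
  by rewrite rmorph0.
have szp : size pf = (size p).-1.+1 by rewrite size_map_poly_id0 ?prednK.
have pf0 : pf != 0 by rewrite -size_poly_gt0 szp.
have szq : (size qf <= (size q).-1.+1)%N.
  by rewrite (leq_trans (size_poly _ _)) ?leqSpred.
(* A row vector in the kernel of the mapped Sylvester matrix is thus a relation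
   [u * pf + w * qf = 0] under the degree bounds of [p] and [q]. *)
have mulS (u : 'rV_(size q).-1) (w : 'rV_(size p).-1) :
    row_mx u w *m map_mx f (Sylvester_mx p q)
      = poly_rV (rVpoly u * pf + rVpoly w * qf).
  have mapS d r : map_mx f (lin1_mx (poly_rV \o r \o* rVpoly)) =
      lin1_mx (poly_rV \o map_poly f r \o* rVpoly) :> 'M_(d, _).
    by apply: map_lin1_mx => v; rewrite map_poly_rV rmorphM /= map_rVpoly.
  by rewrite map_col_mx !mapS mul_row_col !mul_rV_lin1 linearD.
rewrite /resultant -det_map_mx; apply/det0P/idP => [[v v0]|].
  rewrite -[v]hsubmxK in v0 *; set u := lsubmx v in v0 *.
  set w := rsubmx v in v0 *; rewrite mulS => /(congr1 rVpoly).
  rewrite linear0 poly_rV_K => [e|]; last first.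
    rewrite (leq_trans (size_polyD _ _)) // geq_max.
    rewrite !(leq_trans (size_polyMleq _ _)) // -subn1 leq_subLR add1n.
      by rewrite addnC -addSn leq_add ?size_poly.
    by rewrite -addnS leq_add ?size_poly ?szp.
  apply: contraNN v0 => co.
  (* By the relation [e], [pf] divides [w * qf], hence [w] by coprimality, but [w] has smaller
     degree than [pf]. *)
  have w0 : rVpoly w = 0.
    have sw : (size (rVpoly w) <= (size p).-1)%N by exact: size_poly.
    apply/eqP; apply: contraTT sw => w0.
    rewrite -ltnNge -szp; apply: dvdp_leq => //.
    rewrite -(Gauss_dvdpl _ co).
    rewrite -(dvdp_addr _ (dvdp_mull (rVpoly u) (dvdpp pf))).
    by rewrite e dvdp0.
  have u0 : rVpoly u = 0.
    by apply/eqP; move/eqP: e; rewrite w0 mul0r addr0 mulf_eq0 (negPf pf0) orbF.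
  rewrite -(rVpolyK u) -(rVpolyK w) u0 w0 !linear0 row_mx0; exact/eqP.
move=> nco; set g := gcdp pf qf.
have g0 : g != 0 by rewrite gcdp_eq0 negb_and pf0.
have sg : (1 < size g)%N.
  by rewrite ltn_neqAle eq_sym nco size_poly_gt0.
have pE : pf %/ g * g = pf by rewrite divpK ?dvdp_gcdl.
have qE : qf %/ g * g = qf by rewrite divpK ?dvdp_gcdr.
have szdiv (r : {poly F}) (n : nat) : (size r <= n.+1)%N -> (size (r %/ g)%R <= n)%N.
  move=> h; rewrite size_divp //; move: sg h; case: (size g) => [|[|m]] //= _ h.
  by rewrite (leq_trans (leq_sub2r _ h)) // subSS leq_subr.
(* The cofactors of the nonconstant gcd [g] satisfy the degree bounds and give a nontrivial
   relation. *)
exists (row_mx (poly_rV (qf %/ g)) (- poly_rV (pf %/ g))).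
  apply: contraNneq pf0; rewrite -row_mx0 => /eq_row_mx[_ /eqP].
  rewrite oppr_eq0 => /eqP/(congr1 rVpoly).
  rewrite linear0 poly_rV_K ?szdiv ?szp // => e.
  by rewrite -pE e mul0r.
rewrite mulS linearN /= !poly_rV_K ?szdiv ?szp //.
have -> : qf %/ g * pf = pf %/ g * qf.
  by rewrite -[X in _ * X = _]pE -[X in _ = _ * X]qE mulrCA.
by rewrite mulNr subrr linear0.
Qed.

Lemma size_core_poly (k : nat) (t : k.-tuple int) :
  size (core_poly t) = k.+1.
Proof.
rewrite /core_poly size_polyDl size_polyXn // size_polyN ltnS.
apply: (leq_trans (size_sum _ _ _)); apply/bigmax_leqP => i _.
rewrite (leq_trans (size_scale_leq _ _)) // size_polyXn.
by rewrite -subSn // subSS leq_subr.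
Qed.

Lemma core_poly_monic (k : nat) (t : k.-tuple int) : core_poly t \is monic.
Proof.
rewrite monicE lead_coefE size_core_poly /= coefB coefXn eqxx coef_sum big1.
  by rewrite subr0.
move=> i _; rewrite coefZ coefXn gtn_eqF ?mulr0 //.
by rewrite -subSn // subSS leq_subr.
Qed.

Section Recurrence.

Variables (F : fieldType) (k : nat) (t : k.-tuple int).
Hypothesis k_gt0 : (0 < k)%N.

Let C : {poly F} := map_poly intr (core_poly t).

Lemma map_core_polyE :
  C = 'X^k - \sum_(i < k) (t`_i)%:~R *: 'X^(k - i.+1).
Proof.
rewrite /C /core_poly rmorphB rmorph_sum /= map_polyXn; congr (_ - _).
by apply: eq_bigr => i _; rewrite map_polyZ map_polyXn.
Qed.

Lemma size_map_core_poly : size C = k.+1.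
Proof.
rewrite size_map_poly_id0 ?size_core_poly //.
by rewrite (monicP (core_poly_monic k t)) rmorph1 oner_eq0.
Qed.

Lemma map_core_poly_neq0 : C != 0.
Proof. by rewrite -size_poly_gt0 size_map_core_poly. Qed.

Lemma root0_map_core_poly : root C 0 = ((t`_k.-1)%:~R == 0 :> F).
Proof.
rewrite rootE map_core_polyE hornerD hornerN horner_sum hornerXn expr0n.
rewrite gtn_eqF //.
rewrite sub0r oppr_eq0; case: k k_gt0 t => // n _ s /=.
rewrite big_ord_recr /= subnn expr0 hornerZ hornerC mulr1 big1 ?add0r // => i _.
by rewrite hornerZ hornerXn expr0n subn_eq0 ltnS leqNgt ltn_ord mulr0.
Qed.

(* The right-hand side is the linear functional "coefficient of X^(k-1)" on
   F[X]/(C), applied to X^(n+k-1). *)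
Lemma gfib_coef_modp n : (gfib t n)%:~R = ('X^(n + k.-1) %% C)`_k.-1.
Proof.
have small m : (m < k)%N -> ('X^m %% C)`_k.-1 = (k.-1 == m)%:R.
  by move=> mk; rewrite modp_small ?coefXn // size_polyXn size_map_core_poly.
elim/ltn_ind: n => -[|n] IHn; first by rewrite small ?add0n ?eqxx ?prednK.
(* Modulo [C], this is the recurrence for the powers of [X]. *)
have XkE : 'X^(n.+1 + k.-1) =
    'X^n * C + \sum_(i < k) (t`_i)%:~R *: 'X^(n + k - i.+1) :> {poly F}.
  rewrite map_core_polyE mulrBr -exprD addSn -addnS prednK // mulr_sumr.
  rewrite -[LHS]addr0 -addrA; congr (_ + _).
  rewrite addrC -sumrB big1 // => i _.
  by rewrite -scalerAr -exprD addnBA ?subrr.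
rewrite XkE modpD modp_mull add0r gfibS rmorph_sum /=.
rewrite (big_morph (fun q => q %% C) (modpD C) (mod0p C)) coef_sum.
apply: eq_bigr => i _; rewrite rmorphM /= modpZl coefZ; congr (_ * _).
(* When [i > n] the exponent lies below [k - 1], so the coefficient is 0, as are the initial values
   at negative indices. *)
have [lein|ltni] := leqP i.+1 n.+1.
  by rewrite IHn; last lia; congr (('X^_ %% _)`_ _); lia.
by have ik := ltn_ord i; rewrite small; [rewrite gtn_eqF //; lia | lia].
Qed.

(** The functional is nondegenerate: a nonzero remainder [s], multiplied by ['X^(k - size s)], has
    degree exactly [k - 1], so the functional returns its leading coefficient. *)
Lemma dvdp_coef_modp r :
  (forall n, (('X^n * r) %% C)`_k.-1 = 0) -> C %| r.
Proof.
move=> h; rewrite /dvdp; set s := r %% C; apply: contraT => s0.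
have ss : (size s <= k)%N.
  by rewrite -ltnS -size_map_core_poly ltn_modpN0 ?map_core_poly_neq0.
have s_gt0 : (0 < size s)%N by rewrite size_poly_gt0.
have := h (k - size s)%N; rewrite -modp_mul -/s modp_small; last first.
  by rewrite mulrC size_mulXn // size_map_core_poly subnK.
move: ss s_gt0; rewrite coefXnM; move Em: (size s) => m ss s_gt0.
rewrite ifF; last by lia.
have -> : (k.-1 - (k - m) = m.-1)%N by lia.
by move/eqP; rewrite -Em -lead_coefE lead_coef_eq0 (negPf s0).
Qed.

Hypothesis tk : (t`_k.-1)%:~R != 0 :> F.

Lemma coprimep_map_core_polyXn n : coprimep C 'X^n.
Proof. by apply: coprimep_expr; rewrite coprimepX root0_map_core_poly. Qed.

Lemma gfib_periodic_dvdp c :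
  (forall n, (gfib t (n + c))%:~R = (gfib t n)%:~R :> F) <-> C %| 'X^c - 1.
Proof.
have shiftE n : 'X^(n + c + k.-1) - 'X^(n + k.-1) =
    'X^n * ('X^(k.-1) * ('X^c - 1)) :> {poly F}.
  by rewrite !mulrBr !mulr1 -!exprD; congr ('X^_ - 'X^_); lia.
split=> [per|dvd n].
  (* The offset [k - 1] in the functional leaves a factor ['X^(k.-1)], harmless because [X] is
     invertible modulo [C]. *)
  rewrite -(Gauss_dvdpr _ (coprimep_map_core_polyXn k.-1)).
  apply: dvdp_coef_modp => n; rewrite -shiftE modpD modpN coefD coefN.
  by rewrite -!gfib_coef_modp per subrr.
apply/eqP; rewrite -subr_eq0 !gfib_coef_modp -coefN -modpN -coefD -modpD shiftE.
by rewrite (modp_eq0 (dvdp_mull _ (dvdp_mull _ dvd))) coef0.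
Qed.

End Recurrence.

(** Pigeonhole: two powers of [X] share a remainder modulo [q], and the smaller one cancels since it
    is coprime to [q]. *)
Lemma dvdp_Xn_sub1_exists (F : finFieldType) (q : {poly F}) :
  q != 0 -> ~~ root q 0 -> exists2 c, (0 < c)%N & q %| 'X^c - 1.
Proof.
move=> q0 q_root; pose f n : 'rV[F]_(size q) := poly_rV ('X^n %% q).
pose N := #|{: 'rV[F]_(size q)}|.
have /injectivePn[i [j ij fij]] : ~~ injectiveb (fun i : 'I_N.+1 => f i).
  by apply/injectiveP => /leq_card; rewrite card_ord ltnn.
wlog lt_ij : i j ij fij / (i < j)%N.
  move=> W; case: (ltngtP i j) => [| |e]; [exact: W | | ].
    by apply: (W j i); rewrite // eq_sym.
  by rewrite (val_inj e) eqxx in ij.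
exists (j - i)%N; first by rewrite subn_gt0.
have coX : coprimep q 'X^i by apply: coprimep_expr; rewrite coprimepX.
rewrite -(Gauss_dvdpr _ coX) mulrBr mulr1 -exprD subnKC ?(ltnW lt_ij) //.
have := congr1 rVpoly fij; rewrite !poly_rV_K ?(ltnW (ltn_modpN0 _ q0)) // => e.
by rewrite /dvdp modpD modpN e subrr.
Qed.

(** Separability makes the cofactor [e] of [gcdp q g] coprime to that gcd, hence to [g]; as [e] also
    divides [g ^+ n], it is a unit. *)
Lemma separable_dvdp_exp (F : fieldType) (q g : {poly F}) n :
  separable_poly q -> q %| g ^+ n -> q %| g.
Proof.
move=> sq dvd; pose d := gcdp q g; pose e := q %/ d.
have qE : q = e * d by rewrite divpK ?dvdp_gcdl.
have co_ed : coprimep e d by apply: (separable_coprime sq); rewrite -qE.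
have co_eg : coprimep e g.
  apply/coprimepP => h he hg; have hd : h %| d.
    by rewrite dvdp_gcd hg andbT (dvdp_trans he) // qE dvdp_mulr.
  by move/coprimepP: co_ed; apply.
have : e %| g ^+ n by rewrite (dvdp_trans _ dvd) // qE dvdp_mulr.
move=> e_dvd; have e1 : e %= 1.
  rewrite -size_poly_eq1 -coprimepp; exact: coprimep_dvdl e_dvd (coprimep_expr _ co_eg).
by rewrite qE (eqp_dvdl _ (eqp_mulr _ e1)) mul1r dvdp_gcdr.
Qed.

Lemma separable_least_exponent (F : fieldType) (p c : nat) (q : {poly F}) :
  p \in [pchar F] -> (0 < c)%N -> q %| 'X^c - 1 ->
  (forall d, (0 < d)%N -> q %| 'X^d - 1 -> (c <= d)%N) ->
  separable_poly q = ~~ (p %| c)%N.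
Proof.
move=> pF c_gt0 dvd least; apply/idP/idP => [sq|ndvd].
  apply/negP => /dvdnP[m cE]; have p_pr := pcharf_prime pF.
  have pP : p \in [pchar {poly F}] by rewrite pchar_poly.
  have m_gt0 : (0 < m)%N by move: c_gt0; rewrite cE muln_gt0 => /andP[].
  have XcE : 'X^c - 1 = ('X^m - 1) ^+ p :> {poly F}.
    rewrite -(pFrobenius_autE pP) (pFrobenius_autB_comm pP (commr1 _)).
    by rewrite pFrobenius_aut1 pFrobenius_autE -exprM cE.
  rewrite XcE in dvd; have := least _ m_gt0 (separable_dvdp_exp _ _ _ _ sq dvd).
  by rewrite cE leqNgt ltn_Pmulr ?prime_gt1.
apply: dvdp_separable dvd _; apply: separable_Xn_sub_1.
by rewrite -(dvdn_pcharf pF).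
Qed.

Theorem theorem6p7 (k : nat) (t : k.-tuple int)
    (C_irr : irreducible_poly (map_poly (intr : int -> rat) (core_poly t)))
    (K : fieldExtType rat) (lambda : K)
    (lambda_root : root (map_poly (intr : int -> K) (core_poly t)) lambda)
    (K_gen : <<1; lambda>>%VS = fullv)
    (p : nat) (p_prime : prime p)
    (p_ndvd : ~~ (p%:Z %| t`_k.-1)%Z)
    (ram_disc : ramifies K p <-> (p%:Z %| discriminant (core_poly t))%Z) :
  (p %| gfib_period p t)%N <-> ramifies K p.
Proof.
have pF := pchar_Fp p_prime.
have k_gt0 : (0 < k)%N by case: C_irr; rewrite size_map_core_poly.
have tk : (t`_k.-1)%:~R != 0 :> 'F_p by rewrite -(dvdz_pcharf pF).
pose C : {poly 'F_p} := map_poly intr (core_poly t).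
have perP c : gfib_period_of t p c <-> (0 < c)%N /\ C %| 'X^c - 1.
  rewrite -(gfib_periodic_dvdp _ _ _ k_gt0 tk).
  have modE (a b : int) : (a = b %[mod p%:Z])%Z <-> a%:~R = b%:~R :> 'F_p.
    split=> /eqP.
      rewrite eqz_mod_dvd (dvdz_pcharf pF) rmorphB subr_eq0; exact/eqP.
    by rewrite -subr_eq0 -rmorphB -(dvdz_pcharf pF) -eqz_mod_dvd => /eqP.
  by split=> -[c_gt0 h]; split=> // n; apply/modE.
(* A least period exists, so [gfib_period] is not the default value 0, which [p] would divide. *)
have [] : [set c | gfib_period_of t p c /\
    forall d, gfib_period_of t p d -> (c <= d)%N] (gfib_period p t).
  apply: xgetPex.
  have C_root : ~~ root C 0 by rewrite root0_map_core_poly.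
  have [c c_gt0 dvd] :=
    dvdp_Xn_sub1_exists _ _ (map_core_poly_neq0 _ _ t) C_root.
  have ex : exists c, (0 < c)%N && (C %| 'X^c - 1) by exists c; rewrite c_gt0.
  have [m /andP[m0 mdvd] m_le] := ex_minnP ex.
  exists m; split; first exact/perP.
  by move=> d /perP[d0 ddvd]; apply: m_le; rewrite d0.
move=> /perP[c_gt0 dvd] least; rewrite ram_disc.
have sepE : separable_poly C = ~~ (p %| gfib_period p t)%N.
  apply: separable_least_exponent => // d d_gt0 ddvd; exact/least/perP.
(* Up to sign the discriminant is the resultant of a monic polynomial and its derivative; the
   derivative may drop in degree modulo [p], but vanishing of the resultant still detects
   inseparability. *)
rewrite -[(p %| _)%N]negbK -sepE /discriminant (dvdz_pcharf pF) rmorphMsign.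
rewrite mulrI_eq0; last exact/lregX/lregN/lreg1.
rewrite resultant_morph_eq0 -?deriv_map ?unlock //.
by rewrite (monicP (core_poly_monic k t)) rmorph1 oner_eq0.
Qed.
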